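(* Let $u\in(\mathbb{R}^m)^{\mathbf{T}}$ and $L\in\mathbf{T}$. If $u$ is persistently exciting of order $L$ for $\mathcal{A}$, then it is persistently exciting of order $L$ for $\mathcal{L}$. Conversely, if $u$ is persistently exciting of order $L+1$ for $\mathcal{L}$, then it is persistently exciting of order $L$ for $\mathcal{A}$.
   Context: $\mathbf{T}=\{1,\dots,T\}$ for a positive integer $T$. For $u\in(\mathbb{R}^m)^{\mathbf{T}}$ and $L\in\mathbf{T}$, the Hankel matrix $H_L(u)\in\mathbb{R}^{mL\times(T-L+1)}$ has $j$-th column $\operatorname{col}(u(j),u(j+1),\dots,u(j+L-1))$, $j=1,\dots,T-L+1$. $\mathbb{1}$ is the all-ones column vector of appropriate size. For $K\in\mathbf{T}$: $u$ is persistently exciting of order $K$ for the model class $\mathcal{L}$ (linear time-invariant systems) if $\operatorname{rank}H_K(u)=mK$; $u$ is persistently exciting of order $K$ for the model class $\mathcal{A}$ (affine time-invariant systems) if $\operatorname{rank}\begin{bmatrix}H_K(u)\\ \mathbb{1}^{\top}\end{bmatrix}=mK+1$. *)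

(* Defs.v *)
From mathcomp Require Import all_boot all_algebra reals.

Set Implicit Arguments.
Unset Strict Implicit.
Unset Printing Implicit Defensive.

Local Open Scope ring_scope.

(* A signal u in (R^m)^{1,...,T} is a function u : 'I_T -> 'cV[R]_m; the
   ordinal t : 'I_T stands for the time instant t + 1. *)

Lemma hankel_time_lt (T L : nat) (hL : (0 < L <= T)%N)
  (k : 'I_L) (j : 'I_(T - L + 1)) : (j + k < T)%N.
Proof.
case/andP: hL => _ leLT; case: k j => k ltk [j /= ltj].
rewrite addn1 ltnS in ltj.
by rewrite -(subnK leLT) -addnS; exact: leq_add.
Qed.

Definition hankel_time (T L : nat) (hL : (0 < L <= T)%N)
  (k : 'I_L) (j : 'I_(T - L + 1)) : 'I_T := Ordinal (hankel_time_lt hL k j).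

(* The number of rows is m * L, in the form \sum_(k < L) m that \mxcol
   produces. *)
Definition hankel (R : realType) (m T L : nat) (hL : (0 < L <= T)%N)
  (u : 'I_T -> 'cV[R]_m) : 'M[R]_(\sum_(k < L) m, T - L + 1) :=
  \matrix_(i, j) (\mxcol_(k < L) u (hankel_time hL k j)) i 0.

(* In both definitions the existential over a proof of 0 < K <= T says that
   the order K belongs to {1,...,T}, outside of which H_K(u) is undefined. *)
Definition persistently_exciting_linear (R : realType) (m T : nat)
  (K : nat) (u : 'I_T -> 'cV[R]_m) : Prop :=
  exists hK : (0 < K <= T)%N, \rank (hankel hK u) = (m * K)%N.

Definition persistently_exciting_affine (R : realType) (m T : nat)
  (K : nat) (u : 'I_T -> 'cV[R]_m) : Prop :=
  exists hK : (0 < K <= T)%N,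
    \rank (col_mx (hankel hK u) (const_mx 1 : 'rV[R]_(T - K + 1)))
      = (m * K + 1)%N.

(* Main.v *)
(** If a row vector [x] and a scalar [c] satisfy [x H_L(u) + c 1^T = 0], then
    subtracting consecutive columns shows that [(x, 0) - (0, x)] lies in the
    left kernel of [H_(L+1)(u)]. That kernel being trivial, the blocks of [x]
    vanish one after the other, and then so does [c]. *)

Require Import Defs.
From mathcomp Require Import all_boot all_algebra reals.

Set Implicit Arguments.
Unset Strict Implicit.
Unset Printing Implicit Defensive.

Import GRing.Theory.

Local Open Scope ring_scope.

(** A left-kernel vector of [A], padded with zeros, is a left-kernel vector of the stacked
    matrix. *)
Lemma row_free_col_mxl (F : fieldType) (m1 m2 n : nat)
  (A : 'M[F]_(m1, n)) (B : 'M[F]_(m2, n)) :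
  row_free (col_mx A B) -> row_free A.
Proof.
move=> AB_free; apply: inj_row_free => v vA0.
have: row_mx v 0 *m col_mx A B = 0 by rewrite mul_row_col vA0 mul0mx addr0.
by move/eqP; rewrite mulmx_free_eq0 // -row_mx0 => /eqP/eq_row_mx[].
Qed.

Lemma sum_nat_ord_const (m L : nat) : (\sum_(k < L) m = m * L)%N.
Proof. by rewrite sum_nat_const card_ord mulnC. Qed.

Lemma persistently_exciting_linearP (R : realType) (m T K : nat)
  (u : 'I_T -> 'cV[R]_m) :
  persistently_exciting_linear K u <->
  exists hK : (0 < K <= T)%N, row_free (hankel hK u).
Proof.
split=> -[hK H]; exists hK; move: H; rewrite /row_free.
  by move=> rankH; apply/eqP/(etrans rankH); rewrite sum_nat_ord_const.
by move=> /eqP rankH; apply: (etrans rankH); rewrite sum_nat_ord_const.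
Qed.

Lemma persistently_exciting_affineP (R : realType) (m T K : nat)
  (u : 'I_T -> 'cV[R]_m) :
  persistently_exciting_affine K u <->
  exists hK : (0 < K <= T)%N,
    row_free (col_mx (hankel hK u) (const_mx 1 : 'rV[R]_(T - K + 1))).
Proof.
split=> -[hK H]; exists hK; move: H; rewrite /row_free.
  by move=> rankH; apply/eqP/(etrans rankH); rewrite sum_nat_ord_const.
by move=> /eqP rankH; apply: (etrans rankH); rewrite sum_nat_ord_const.
Qed.

Lemma mul_mxrow_hankel (R : realType) (m T L : nat) (hL : (0 < L <= T)%N)
  (u : 'I_T -> 'cV[R]_m) (x : 'I_L -> 'rV[R]_m) (j : 'I_(T - L + 1)) :
  ((\mxrow_k x k) *m hankel hL u) 0 j =
  \sum_(k < L) (x k *m u (hankel_time hL k j)) 0 0.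
Proof.
rewrite -summxE -mul_mxrow_mxcol !mxE.
by apply: eq_bigr => i _; rewrite [hankel _ _ _ _]mxE.
Qed.

(** The hypothesis equates two families of length [L + 1]: [x] followed by a zero, and [x] preceded
    by a zero. Hence the first entry is 0 and each later entry equals its predecessor. *)
Lemma eq_shift_eq0 (V : nmodType) (L : nat) (x : 'I_L -> V) :
  (forall k, oapp x 0 (unlift ord_max k) = oapp x 0 (unlift ord0 k)) ->
  forall k, x k = 0.
Proof.
move=> eq_x k; have [n] := ubnP k; elim: n k => // n IHn k lt_kn.
have := eq_x (lift ord_max k); rewrite liftK /= => ->.
(* For [k = 0] the default value 0 appears; otherwise [i] is the predecessor of [k]. *)
case: unliftP => //= i eq_ki; apply: IHn; rewrite -ltnS.
by rewrite -[(i.+1)%N]/(nat_of_ord (lift ord0 i)) -eq_ki lift_max.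
Qed.

Lemma hankel_affine_row_free (R : realType) (m T L : nat)
  (hL : (0 < L <= T)%N) (hL1 : (0 < L.+1 <= T)%N) (u : 'I_T -> 'cV[R]_m) :
  row_free (hankel hL1 u) ->
  row_free (col_mx (hankel hL u) (const_mx 1 : 'rV[R]_(T - L + 1))).
Proof.
move=> H_free; apply: inj_row_free => v.
rewrite -[v]hsubmxK mul_row_col -[lsubmx v]submxrowK.
set x := submxrow _; set c := rsubmx v => vH0.
have colE (j : 'I_(T - L + 1)) :
    \sum_(k < L) (x k *m u (hankel_time hL k j)) 0 0 = - c 0 0.
  have /matrixP/(_ 0 j) := vH0.
  rewrite mxE mul_mxrow_hankel [X in _ + X]mxE big_ord1 !mxE mulr1.
  by move/eqP; rewrite addr_eq0 => /eqP.
(* In [L + 1] blocks, [a] is [(x, 0)] and [b] is [(0, x)]. *)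
pose a k := oapp x 0 (unlift ord_max k).
pose b k := oapp x 0 (unlift ord0 k).
have ab0 : \mxrow_k (a k - b k) = 0.
  apply/eqP; rewrite -(mulmx_free_eq0 _ H_free); apply/eqP/rowP => j.
  rewrite mul_mxrow_hankel mxE.
  under eq_bigr do rewrite mulmxBl mxE [(- _ : 'M__) _ _]mxE.
  (* The matrix of order [L + 1] has one column fewer than that of order [L], so [j] and [j + 1]
     both index columns of the latter. *)
  have lt_j1 : (j.+1 < T - L + 1)%N.
    have -> : (T - L + 1 = (T - L.+1 + 1).+1)%N.
      by have /andP[_ ltLT] := hL1; rewrite !addn1 -(subSn ltLT) subSS.
    by rewrite ltnS ltn_ord.
  (* Drop the zero block of each sum: the last one for [a], the first one for [b]. *)
  rewrite sumrB (bigD1_ord ord_max) //= (bigD1_ord ord0 (P := xpredT)) //=.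
  rewrite /a /b !unlift_none /= !mul0mx mxE !add0r.
  apply/eqP; rewrite subr_eq0; apply/eqP.
  (* What remains is [x] applied to columns [j] and [j + 1] of the order-[L] matrix; by [colE] both
     give the same constant. *)
  transitivity (- c 0 0); last rewrite -(colE (Ordinal lt_j1)).
    rewrite -(colE (Ordinal (ltnW lt_j1))); apply: eq_bigr => k _.
    rewrite liftK /=; congr ((_ *m u _) 0 0); apply: val_inj => /=.
    by rewrite -[bump _ _]/(nat_of_ord (lift ord_max k)) lift_max.
  apply: eq_bigr => k _.
  rewrite liftK /=; congr ((_ *m u _) 0 0); apply: val_inj => /=.
  exact: addSnnS.
have x0 : forall k, x k = 0.
  apply: eq_shift_eq0 => k; apply/eqP; rewrite -subr_eq0; apply/eqP.
  by rewrite -[LHS](mxrowK (fun k => a k - b k)) ab0 submxrow0.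
(* Any single column now forces [c = 0]; the first one always exists. *)
have lt_0 : (0 < T - L + 1)%N by rewrite addn1.
have := colE (Ordinal lt_0); rewrite big1 => [/eqP|k _]; last first.
  by rewrite x0 mul0mx mxE.
rewrite eq_sym oppr_eq0 => /eqP c0.
have -> : c = 0 by apply/matrixP=> i k; rewrite !ord1 c0 mxE.
have -> : \mxrow_k x k = 0 by rewrite -mxrow0; apply/eq_mxrow => k; rewrite x0.
by rewrite row_mx0.
Qed.

Theorem lemma3 (R : realType) (m T : nat) (hT : (0 < T)%N)
  (u : 'I_T -> 'cV[R]_m) (L : nat) (hL : (0 < L <= T)%N) :
  (persistently_exciting_affine L u -> persistently_exciting_linear L u) /\
  (persistently_exciting_linear (L + 1) u -> persistently_exciting_affine L u).
Proof.
split=> [/persistently_exciting_affineP[hK H_free]|].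
  apply/persistently_exciting_linearP; exists hK.
  exact: row_free_col_mxl H_free.
rewrite addn1 => /persistently_exciting_linearP[hL1 H_free].
apply/persistently_exciting_affineP; exists hL.
exact: hankel_affine_row_free H_free.
Qed.
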